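(* Let $d\ge 2$ and let $P_2(L)$ be the number of polygons in the hypercube of side $L$ in $\mathbb{Z}^d$ that have at least one edge in each of the two faces of at least one pair of opposite faces of the hypercube. Then, as $L\to\infty$, $$P_2(L)\le\lambda_d^{\,L^d+2dL^{d-1}+o(L^{d-1})} ,$$ where $\log\lambda_d=\lim_{L\to\infty}L^{-d}\log C(L)$ and $C(L)$ is the number of self-avoiding walks that cross the hypercube of side $L$ from one corner vertex to the diagonally opposite corner vertex.
   Context: For a positive integer $L$, the hypercube of side $L$ is the subgraph of the lattice $\mathbb{Z}^d$ (nearest-neighbour edges, coordinates $(x_1,\dots,x_d)$) induced by the vertex set $\{0,1,\dots,L\}^d$. Its pairs of opposite faces are $x_k=0$ and $x_k=L$, for $k=1,\dots,d$; an edge is in a face if both its endpoints are. A self-avoiding walk is a nearest-neighbour lattice path that visits no vertex more than once. $C(L)$ counts the self-avoiding walks that stay in the hypercube of side $L$, start at a fixed corner vertex (say $(0,\dots,0)$) and end at the diagonally opposite corner vertex (say $(L,\dots,L)$). The limit $\lim_{L\to\infty}L^{-d}\log C(L)$ exists and is finite; $\lambda_d$ is defined by setting this limit equal to $\log\lambda_d$. A polygon is a simple closed cycle, regarded as an (unrooted, unoriented) subgraph of the lattice; polygons are counted as distinct subgraphs of the fixed hypercube (translates are counted as different). The displayed inequality means that there is a function $r(L)$ with $r(L)/L^{d-1}\to0$ as $L\to\infty$ such that $\log P_2(L)\le(L^d+2dL^{d-1}+r(L))\log\lambda_d$ for all $L$. *)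

(* Defs.v *)
From HB Require Import structures.
From mathcomp Require Import all_boot all_order all_algebra.
From mathcomp Require Import all_classical all_reals all_analysis.
Set Implicit Arguments.
Unset Strict Implicit.
Unset Printing Implicit Defensive.
Import Order.TTheory GRing.Theory Num.Theory.
Import numFieldNormedType.Exports.

Local Open Scope ring_scope.

(** Vertices of the hypercube; the coordinates range over {0, ..., L}, so the
    side [L] counts edges rather than sites. *)
Definition site (d L : nat) := {ffun 'I_d -> 'I_L.+1}.

(** Distance 1 in the l^1 norm; [`|_ - _|] is the distance in [int], not the
    truncated or modular difference. *)
Definition adj d L : rel (site d L) :=
  fun x y => (\sum_(k < d) `|x k - y k|%N)%N == 1%N.

Definition corner0 d L : site d L := [ffun=> ord0].
Definition cornerL d L : site d L := [ffun=> ord_max].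

(** [p] lists the sites visited after the starting corner, so that the walk
    itself is [corner0 d L :: p]. *)
Definition crossing d L (p : seq (site d L)) : bool :=
  [&& path (@adj d L) (corner0 d L) p,
      uniq (corner0 d L :: p)
    & last (corner0 d L) p == cornerL d L].

(** Bounding the length of [p] by the number of sites is no restriction, since
    the sites of [p] are distinct; it only makes the type finite. *)
Definition num_crossings d L : nat :=
  #|[set p : {bseq #|{: site d L}| of site d L} | crossing p]|.

(** A polygon is represented by its set of edges, an edge being the set of its
    two endpoints, so that it carries neither root nor orientation. *)
Definition cycle_edges d L (c : seq (site d L)) : {set {set site d L}} :=
  [set [set x; next c x] | x in c].

(** [2 < size c] excludes the two-site "cycle" that traverses one edge twice. *)
Definition polygon d L (E : {set {set site d L}}) : Prop :=
  exists c : seq (site d L),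
    [/\ (2 < size c)%N, uniq c, cycle (@adj d L) c & E = cycle_edges c].

Definition face d L (k : 'I_d) (a : 'I_L.+1) : {set site d L} :=
  [set x : site d L | x k == a].

Definition has_edge_in d L (E : {set {set site d L}}) (F : {set site d L}) :
    bool :=
  [exists e in E, e \subset F].

Definition spanning d L (E : {set {set site d L}}) : bool :=
  [exists k : 'I_d,
     has_edge_in E (face k ord0) && has_edge_in E (face k ord_max)].

Definition num_spanning_polygons d L : nat :=
  #|[set E : {set {set site d L}} | `[< polygon E >] && spanning E]|.

Definition crossing_growth (R : realType) d : R :=
  limn (fun L => ln (num_crossings d L)%:R / L%:R ^+ d : R).

Definition lambda (R : realType) d : R := expR (crossing_growth R d).

(* Main.v *)
(** A polygon with an edge {a, a + e_j} in the face x_k = 0 is lifted by one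
    layer in direction k and cut at that edge.  In the layer thus freed, a
    monotone walk leads from the corner 0 to a, and another one from a + e_j to
    the corner of that layer opposite to 0; a walk up in direction k then ends
    at the opposite corner of a hypercube of side L + 1.  The polygon can be read
    off the resulting crossing, so P_2(L) <= d C(L + 1).

    Stacking an odd number of crossings along an axis, every second one being
    reflected in the other axes, gives C(L)^(m^d) <= C(m (L + 1) - 1) for odd m.
    Hence ln C(L) <= (L + 1)^d ln lambda, and
    ln P_2(L) <= (L + 2)^d ln lambda + ln d.  The term ln d is absorbed into r(L)
    because lambda > 1, which follows from C(1) >= 2. *)
Require Import Defs.
From HB Require Import structures.
From mathcomp Require Import all_boot all_order all_algebra.
From mathcomp Require Import all_classical all_reals all_analysis.
From mathcomp Require Import zify ring.
Import Order.TTheory GRing.Theory Num.Theory.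
Import numFieldNormedType.Exports.
Set Implicit Arguments.
Unset Strict Implicit.
Unset Printing Implicit Defensive.

Local Open Scope nat_scope.

(** * Self-avoiding walks in the lattice *)

(** Unlike [site d L], not tied to one cube: boxes of different shapes have to
    be placed side by side. *)
Definition gridpt d := {ffun 'I_d -> nat}.

Definition padj d : rel (gridpt d) :=
  fun x y => \sum_(k < d) `|x k - y k| == 1.

Definition pincr d (k : 'I_d) (x : gridpt d) : gridpt d :=
  [ffun i => if i == k then (x i).+1 else x i].

Definition ple d : rel (gridpt d) := fun x y => [forall k, x k <= y k].

Definition pconst d n : gridpt d := [ffun=> n].

Lemma pleP d (x y : gridpt d) : reflect (forall k, x k <= y k) (ple x y).
Proof. exact: forallP. Qed.

Lemma ple_refl d (x : gridpt d) : ple x x.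
Proof. exact/pleP. Qed.

Lemma ple_trans d : transitive (@ple d).
Proof. by move=> y x z /pleP xy /pleP yz; apply/pleP => k; apply: leq_trans (yz k). Qed.

Lemma padj_sym d : symmetric (@padj d).
Proof. by move=> x y; rewrite /padj; under eq_bigr do rewrite distnC. Qed.

Lemma padj_pincr d k (x : gridpt d) : padj x (pincr k x).
Proof.
rewrite /padj (bigD1 k) //= big1 => [|i /negPf ik]; rewrite ffunE ?eqxx ?ik; lia.
Qed.

Lemma padjP d (x y : gridpt d) :
  padj x y -> exists k, y = pincr k x \/ x = pincr k y.
Proof.
move=> /eqP sum1.
have [k xyk] : exists k : 'I_d, x k != y k.
  apply/existsP; apply: contra_eqT sum1; rewrite negb_exists => /forallP xy.
  by rewrite big1 // => i _; rewrite (eqP (negPn (xy i))) distnn.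
exists k; move: sum1; rewrite (bigD1 k) //=; set s := (X in _ + X) => sum1.
have [/eqP s0 dk] : s = 0 /\ `|x k - y k| = 1 by move: xyk sum1; clearbody s; lia.
move: s0; rewrite /s {s sum1} sum_nat_eq0 => /forallP xy.
have {}xy i : i != k -> x i = y i by move=> ik; have := implyP (xy i) ik; lia.
have [yx|xy'] : y k = (x k).+1 \/ x k = (y k).+1.
  by move: (x k) (y k) dk => a b; lia.
- by left; apply/ffunP => i; rewrite ffunE; case: eqVneq => [->|/xy].
- by right; apply/ffunP => i; rewrite ffunE; case: eqVneq => [->|/xy].
Qed.

(** Unlike in [crossing], the list includes the starting point, so joining two walks is plain
    concatenation of lists and the empty list is not a walk. *)
Definition saw d (x y : gridpt d) (w : seq (gridpt d)) : bool :=
  if w is h :: t then [&& h == x, path (@padj d) h t, uniq w & last h t == y]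
  else false.

Lemma saw_cat d (x y x' y' : gridpt d) w w' :
    saw x y w -> saw x' y' w' -> padj y x' -> {in w', forall z, z \notin w} ->
  saw x y' (w ++ w').
Proof.
case: w w' => [|h t] // [|h' t'] //.
case/and4P=> /eqP-> pt ut /eqP lt /and4P[/eqP-> pt' ut' /eqP lt'] adjy dis.
have uw : uniq ((x :: t) ++ x' :: t').
  by rewrite cat_uniq ut ut' andbT; apply/hasPn => z /dis.
by rewrite /saw cat_cons -cat_cons uw eqxx cat_path last_cat /= pt lt adjy pt' lt' eqxx.
Qed.

(** The hypotheses on [f] concern only the points of [w]: the reflection used for stacking is
    written with truncated subtraction and is injective only inside its box. *)
Lemma saw_map d (f : gridpt d -> gridpt d) x y w :
    {in w &, injective f} ->
    {in w &, forall u v, padj u v -> padj (f u) (f v)} ->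
  saw x y w -> saw (f x) (f y) (map f w).
Proof.
case: w => [|h t] // fI fadj /and4P[/eqP <- pt ut /eqP <-].
rewrite /saw map_cons -map_cons (map_inj_in_uniq fI) ut eqxx last_map eqxx andbT {ut fI} /=.
rewrite andbT; elim: t h {x y} fadj pt => //= z t IH h fadj /andP[hz zt].
rewrite fadj ?inE ?eqxx ?orbT //=; apply: IH => // u v ut vt.
by apply: fadj; rewrite inE ?ut ?vt orbT.
Qed.

(** A monotone walk, built by induction on the l^1 distance. After a first step in direction [k]
    every later point has a larger coordinate [k] than [x], so [x] is never revisited. *)
Lemma saw_between d (x y : gridpt d) :
  ple x y -> exists w, saw x y w /\ {in w, forall z, ple x z /\ ple z y}.
Proof.
move=> /pleP xy; have [n] := ubnP (\sum_k (y k - x k)).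
elim: n x xy => // n IH x xy lt_n.
have [-> | nxy] := eqVneq x y.
  by exists [:: y]; split=> [|z]; rewrite /= ?eqxx // inE => /eqP->; rewrite ple_refl.
have [k ltk] : exists k : 'I_d, x k < y k.
  apply/existsP; apply: contraNT nxy; rewrite negb_exists => /forallP yx.
  by apply/eqP/ffunP => k; apply/eqP; rewrite eqn_leq xy leqNgt yx.
have x'y i : pincr k x i <= y i by rewrite ffunE; case: eqP => [->|].
have [|w [saww betw]] := IH (pincr k x) x'y.
  move: lt_n; rewrite (bigD1 k) //= [X in _ -> X < _](bigD1 k) //= ffunE eqxx.
  under [X in _ -> _ + X < _]eq_bigr => i /negPf ik do rewrite ffunE ik.
  lia.
have xx' : ple x (pincr k x) by apply/pleP => i; rewrite ffunE; case: ifP.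
exists (x :: w); split; last first.
  move=> z; rewrite inE => /orP[/eqP-> | /betw [x'z zy]].
    by split; [exact: ple_refl | exact/pleP].
  by split=> //; apply: ple_trans x'z.
rewrite -cat1s; apply: (saw_cat _ saww (padj_pincr k x)).
  by rewrite /= !eqxx.
move=> z /betw [/pleP /(_ k) x'z _]; rewrite inE; apply: contraTneq x'z => ->.
by rewrite ffunE eqxx -ltnNge.
Qed.

(** * Crossings of boxes as lists of lattice points *)

Definition pcrossing d (t : gridpt d) (w : seq (gridpt d)) : bool :=
  saw (pconst d 0) t w && all (@ple d ^~ t) w.

Definition pt_of_site d L (x : site d L) : gridpt d := [ffun k => x k : nat].
(** A coordinate above [L] is sent to 0 by [inord]; the map is meaningful only on the cube of side
    [L]. *)
Definition site_of_pt d L (z : gridpt d) : site d L := [ffun k => inord (z k)].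

Lemma pt_of_siteK d L : cancel (@pt_of_site d L) (@site_of_pt d L).
Proof. by move=> x; apply/ffunP => k; rewrite !ffunE inord_val. Qed.

Lemma site_of_ptK d L (z : gridpt d) :
  ple z (pconst d L) -> pt_of_site (site_of_pt L z) = z.
Proof.
move=> /pleP zL; apply/ffunP => k; rewrite !ffunE inordK //.
by have := zL k; rewrite ffunE.
Qed.

Lemma ple_pt_of_site d L (x : site d L) : ple (pt_of_site x) (pconst d L).
Proof. by apply/pleP => k; rewrite !ffunE -ltnS. Qed.

Lemma padj_pt_of_site d L (x y : site d L) : padj (pt_of_site x) (pt_of_site y) = adj x y.
Proof. by rewrite /padj /adj; under eq_bigr do rewrite !ffunE. Qed.

Lemma pt_of_corner0 d L : pt_of_site (corner0 d L) = pconst d 0.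
Proof. by apply/ffunP => k; rewrite !ffunE. Qed.

Lemma pt_of_cornerL d L : pt_of_site (cornerL d L) = pconst d L.
Proof. by apply/ffunP => k; rewrite !ffunE. Qed.

Definition pcrossings d L : seq (seq (gridpt d)) :=
  [seq map (@pt_of_site d L) (corner0 d L :: val p) | p : {bseq #|{: site d L}| of site d L}
       in [set p : {bseq #|{: site d L}| of site d L} | crossing p]].

Lemma size_pcrossings d L : size (pcrossings d L) = num_crossings d L.
Proof. by rewrite size_map -cardE. Qed.

Lemma uniq_pcrossings d L : uniq (pcrossings d L).
Proof.
rewrite map_inj_uniq ?enum_uniq //. move=> p q. case. move=>/(inj_map (can_inj (@pt_of_siteK d L))).
exact: val_inj.
Qed.

Lemma mem_pcrossings d L w : (w \in pcrossings d L) = pcrossing (pconst d L) w.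
Proof.
have pt_inj := can_inj (@pt_of_siteK d L).
have padj_pt x p : path (@padj d) (pt_of_site x) (map (@pt_of_site d L) p) = path (@adj d L) x p.
  by elim: p x => //= y p IH x; rewrite padj_pt_of_site IH.
apply/idP/idP => [/fintype.imageP[p] | /andP[]].
  rewrite inE => /and3P[pp up lp] ->.
  rewrite /pcrossing /saw map_cons pt_of_corner0 eqxx -(pt_of_corner0 d L) padj_pt pp.
  rewrite -map_cons map_inj_uniq // up last_map (eqP lp) pt_of_cornerL eqxx /=.
  by rewrite ple_pt_of_site; apply/allP => _ /mapP[x _ ->]; exact: ple_pt_of_site.
case: w => [|h t] // /and4P[/eqP-> pt ut lt] /andP[_ /allP tL].
have tK : map (@pt_of_site d L) (map (@site_of_pt d L) t) = t.
  by rewrite -map_comp -[RHS]map_id; apply/eq_in_map => z /tL zL /=; rewrite site_of_ptK.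
move: pt ut lt; rewrite -(pt_of_corner0 d L) -tK padj_pt -map_cons map_inj_uniq // last_map.
rewrite -(pt_of_cornerL d L) (inj_eq pt_inj); set q := map _ t => pq uq lq.
have sq : size q <= #|{: site d L}|.
  by rewrite -(card_uniqP (andP uq).2) max_card.
apply/fintype.imageP; exists (Bseq sq) => //.
by rewrite inE /crossing /= pq lq; move: uq => /= ->.
Qed.

(** Every lower bound on the number of crossings goes through this: it suffices to list distinct
    ones. *)
Lemma leq_num_crossings d L (S : seq (seq (gridpt d))) :
  uniq S -> {in S, forall w, pcrossing (pconst d L) w} -> size S <= num_crossings d L.
Proof.
move=> uS cS; rewrite -size_pcrossings; apply: uniq_leq_size => // w /cS.
by rewrite mem_pcrossings.
Qed.

(** * An exponential upper bound on the number of crossings *)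

Definition pneighbors d (x : gridpt d) : seq (gridpt d) :=
  [seq pincr k x | k <- enum 'I_d] ++
  [seq [ffun i => if i == k then (x i).-1 else x i] | k <- enum 'I_d].

Lemma mem_pneighbors d (x y : gridpt d) : padj x y -> y \in pneighbors x.
Proof.
case/padjP=> k [-> | ->]; rewrite mem_cat; apply/orP; [left|right]; apply/mapP.
  by exists k; rewrite ?mem_enum.
exists k; rewrite ?mem_enum //; apply/ffunP => i; rewrite !ffunE.
by case: eqP.
Qed.

(** An over-count: [pneighbors] may contain [x] itself, because the predecessor of 0 is 0. Only
    completeness and the size of the list matter. *)
Fixpoint paths_upto d n (x : gridpt d) : seq (seq (gridpt d)) :=
  [::] :: if n is m.+1 then [seq y :: p | y <- pneighbors x, p <- paths_upto m y]
          else [::].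

Lemma mem_paths_upto d n (x : gridpt d) p :
  path (@padj d) x p -> size p <= n -> p \in paths_upto n x.
Proof.
elim: n x p => [|n IH] x [|y p] //= /andP[xy yp] sp.
rewrite inE /=; apply/allpairsPdep; exists y, p; split => //.
  exact: mem_pneighbors.
exact: IH.
Qed.

(** Each point has 2d listed neighbours. The extra 1 in the base pays for the empty path, since 1 +
    2d e <= (2d + 1) e when e >= 1. *)
Lemma size_paths_upto d n (x : gridpt d) :
  size (paths_upto n x) <= (d.*2.+1) ^ n.
Proof.
elim: n x => [|n IH] x //=; rewrite size_allpairs_dep.
have : sumn [seq size (paths_upto n y) | y <- pneighbors x]
       <= size (pneighbors x) * (d.*2.+1) ^ n.
  by elim: pneighbors => //= y s IHs; rewrite mulSn leq_add.
have -> : size (pneighbors x) = d.*2 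
  by rewrite size_cat !size_map -enumT size_enum_ord addnn.
have : 0 < (d.*2.+1) ^ n by rewrite expn_gt0.
rewrite expnS; move: (_ ^ n) => e; move: (sumn _) => s; nia.
Qed.

(** A self-avoiding walk has at most as many steps as the cube has sites. This makes ln C(L) / (L +
    1)^d bounded, so that its supremum is finite. *)
Lemma num_crossings_ub d L : num_crossings d L <= (d.*2.+1) ^ (L.+1 ^ d).
Proof.
rewrite -size_pcrossings.
apply: leq_trans (size_paths_upto (L.+1 ^ d) (pconst d 0)).
rewrite -[leqRHS](size_map (cons (pconst d 0))); apply: uniq_leq_size => [|w wC].
  exact: uniq_pcrossings.
have := wC; rewrite mem_pcrossings => /andP[sw _].
case: w sw wC => // h t /and4P[/eqP-> pt _ _] /fintype.imageP[p _ [_ tE]].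
apply: map_f; apply: mem_paths_upto pt _.
rewrite tE size_map; apply: leq_trans (size_bseq p) _.
by rewrite card_ffun !card_ord.
Qed.

(** * Monotonicity in the side and simple lower bounds *)

Lemma ple_pconst d m n : m <= n -> ple (pconst d m) (pconst d n).
Proof. by move=> mn; apply/pleP => k; rewrite !ffunE. Qed.

(** Every crossing is extended by one fixed monotone walk [u] to the new far corner. All points of
    [u] have coordinate [i] equal to L + 1, so [u] avoids the smaller cube. *)
Lemma num_crossingsS d L : 0 < d -> num_crossings d L <= num_crossings d L.+1.
Proof.
move=> d0; pose i := Ordinal d0; rewrite -size_pcrossings.
have iL : ple (pincr i (pconst d L)) (pconst d L.+1).
  by apply/pleP => k; rewrite !ffunE; case: ifP.
have [u [sawu betu]] := saw_between iL.
rewrite -(size_map (cat^~ u)); apply: leq_num_crossings.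
  rewrite map_inj_uniq ?uniq_pcrossings // => v w /= vw.
  have /(congr1 size) := vw; rewrite !size_cat => /addIn svw.
  by move/eqP: vw; rewrite eqseq_cat // => /andP[/eqP].
move=> _ /mapP[w + ->]; rewrite mem_pcrossings => /andP[saww /allP wL].
rewrite /pcrossing (saw_cat saww sawu (padj_pincr i _)) /=.
  rewrite all_cat; apply/andP; split; apply/allP => z.
    by move/wL/ple_trans; apply; exact: ple_pconst.
  by case/betu.
move=> z /betu[/pleP /(_ i) iz _]; apply/negP => /wL /pleP /(_ i).
by apply/negP; move: iz; rewrite !ffunE eqxx -ltnNge.
Qed.

Lemma leq_num_crossings_side d L M :
  0 < d -> L <= M -> num_crossings d L <= num_crossings d M.
Proof.
move=> d0; elim: M => [|M IH]; first by rewrite leqn0 => /eqP->.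
rewrite leq_eqVlt => /orP[/eqP-> // | /IH LM].
exact: leq_trans LM (num_crossingsS _ d0).
Qed.

(** Two monotone crossings whose first steps go along different axes are distinct. *)
Lemma num_crossings1_gt1 d : 1 < d -> 1 < num_crossings d 1.
Proof.
move=> d1; pose i := Ordinal (ltnW d1); pose j := Ordinal d1.
have w_ (k : 'I_d) : exists w, [/\ pcrossing (pconst d 1) w & nth (pconst d 0) w 1 = pincr k (pconst d 0)].
  have le1 : ple (pincr k (pconst d 0)) (pconst d 1).
    by apply/pleP => l; rewrite !ffunE; case: ifP.
  have [u [sawu betu]] := saw_between le1.
  exists (pconst d 0 :: u); split; last first.
    by case: u sawu {betu} => [|h t] //= /andP[/eqP].
  have ple01 : ple (pconst d 0) (pconst d 1) by exact: ple_pconst.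
  apply/andP; split; last by rewrite /= ple01; apply/allP => z /betu[].
  rewrite -cat1s; apply: (saw_cat _ sawu (padj_pincr k _)); first by rewrite /= !eqxx.
  move=> z /betu[/pleP /(_ k) + _]; rewrite inE; apply: contraTneq => ->.
  by rewrite !ffunE eqxx.
have [u [uC u1]] := w_ i; have [v [vC v1]] := w_ j.
apply: (@leq_num_crossings d 1 [:: u; v]); last first.
  by move=> w; rewrite !inE => /orP[] /eqP->.
rewrite /= inE andbT; apply/eqP => uv; move: u1; rewrite uv v1.
by move/ffunP/(_ i); rewrite !ffunE eqxx.
Qed.

Lemma num_crossings_gt0 d L : 0 < d -> 0 < num_crossings d L.
Proof.
move=> d0; have le0 : ple (pconst d 0) (pconst d L) by exact: ple_pconst.
have [w [saww betw]] := saw_between le0.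
apply: (@leq_num_crossings d L [:: w]) => // u; rewrite inE => /eqP->.
by rewrite /pcrossing saww; apply/allP => z /betw[].
Qed.

(** * Stacking crossings *)

Lemma filter_in_all (T : eqType) (P : pred T) s :
  {in s, forall x, P x} -> [seq x <- s | P x] = s.
Proof. by move=> /allP/all_filterP. Qed.

Lemma filter_in_none (T : eqType) (P : pred T) s :
  {in s, forall x, ~~ P x} -> [seq x <- s | P x] = [::].
Proof. by move=> /hasPn; rewrite has_filter negbK => /eqP. Qed.

Definition setc d (t : gridpt d) (i : 'I_d) n : gridpt d :=
  [ffun k => if k == i then n else t k].

(** [t] is the far corner of a box: the box of [setc t i a] has [a.+1] layers in
    direction [i]. *)
Definition many_crossings d (t : gridpt d) K :=
  exists S : seq (seq (gridpt d)), [/\ uniq S, {in S, forall w, pcrossing t w} & size S = K].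

Lemma pcrossing_le d (t z : gridpt d) w : pcrossing t w -> z \in w -> ple z t.
Proof. by case/andP => _ /allP; apply. Qed.

(** The reflected middle walk starts next to the end of the first walk and ends next to the start of
    the third. Two boxes would leave the walk at 0 in the directions other than [i]; the third
    brings it to the far corner. The boxes have a + b + c + 3 layers in all, hence the last index a
    + b + 2 + c. *)
Lemma many_crossings_stack3 d (t : gridpt d) i a b c A B C :
    many_crossings (setc t i a) A -> many_crossings (setc t i b) B ->
    many_crossings (setc t i c) C ->
  many_crossings (setc t i (a + b + 2 + c)) (A * B * C).
Proof.
move=> [S1 [u1 c1 s1]] [S2 [u2 c2 s2]] [S3 [u3 c3 s3]].
(* [f] moves the second box next to the first and reflects it in all
   directions but [i]; [g] moves the third box next to the second. *)
pose f (z : gridpt d) : gridpt d := [ffun k => if k == i then a.+1 + z k else t k - z k].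
pose g (z : gridpt d) : gridpt d := [ffun k => if k == i then a + b + 2 + z k else z k].
have in1 p z : p \in S1 -> z \in p -> ple z (setc t i a) by move/c1/pcrossing_le; apply.
have in2 q z : q \in S2 -> z \in q -> ple z (setc t i b) by move/c2/pcrossing_le; apply.
have in3 r z : r \in S3 -> z \in r -> ple z (setc t i c) by move/c3/pcrossing_le; apply.
have fi z : f z i = a.+1 + z i by rewrite ffunE eqxx.
have gi z : g z i = a + b + 2 + z i by rewrite ffunE eqxx.
have lei n z : ple z (setc t i n) -> z i <= n by move/pleP/(_ i); rewrite ffunE eqxx.
have lek n z (k : 'I_d) : ple z (setc t i n) -> k != i -> z k <= t k.
  by move/pleP/(_ k); rewrite ffunE => + /negPf ki; rewrite ki.
have f_inj n u v : ple u (setc t i n) -> ple v (setc t i n) -> f u = f v -> u = v.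
  move=> uB vB /ffunP fuv; apply/ffunP => k; have := fuv k; rewrite !ffunE.
  by case: eqVneq => [_|ki]; [move/addnI | move: (u k) (v k) (t k) (lek _ _ _ uB ki) (lek _ _ _ vB ki); lia].
have g_inj : injective g.
  by move=> u v /ffunP guv; apply/ffunP => k; have := guv k; rewrite !ffunE; case: eqP => _ // /addnI.
have f_adj n u v :
    ple u (setc t i n) -> ple v (setc t i n) -> padj u v -> padj (f u) (f v).
  move=> uB vB; congr (_ == _); apply: eq_bigr => k _; rewrite !ffunE.
  by case: eqVneq => [_|ki]; [lia | move: (u k) (v k) (t k) (lek _ _ _ uB ki) (lek _ _ _ vB ki); lia].
have g_adj u v : padj u v -> padj (g u) (g v).
  by congr (_ == _); apply: eq_bigr => k _; rewrite !ffunE; case: eqP => _; lia.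
pose F (x : seq (gridpt d) * seq (gridpt d) * seq (gridpt d)) :=
  x.1.1 ++ (map f x.1.2 ++ map g x.2).
pose X := [seq (x, r) | x <- [seq (p, q) | p <- S1, q <- S2], r <- S3].
have XE x : x \in X -> [/\ x.1.1 \in S1, x.1.2 \in S2 & x.2 \in S3].
  by case/allpairsP=> -[y r] /= [/allpairsP[[p q] /= [pS qS ->]] rS ->].
have uX : uniq X.
  apply: allpairs_uniq => //; last by move=> [? ?] [? ?].
  by apply: allpairs_uniq => // -[? ?] [? ?].
exists (map F X); split; last by rewrite size_map !size_allpairs s1 s2 s3.
  rewrite map_inj_in_uniq // => x y /XE[x1 x2 x3] /XE[y1 y2 y3] xy.
  (* The boxes occupy disjoint ranges of coordinate [i], so filtering by it cuts the joined walk
     back into its three pieces; this makes [F] injective. *)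
  have dec (z : seq (gridpt d) * seq (gridpt d) * seq (gridpt d)) :
      z.1.1 \in S1 -> z.1.2 \in S2 -> z.2 \in S3 ->
    [/\ [seq v : gridpt d <- F z | v i <= a] = z.1.1,
        [seq v : gridpt d <- F z | a < v i <= a + b + 1] = map f z.1.2
      & [seq v : gridpt d <- F z | a + b + 1 < v i] = map g z.2].
    move=> z1 z2 z3; rewrite !filter_cat; split.
    - rewrite filter_in_all => [|v /(in1 _ _ z1)/lei //].
      rewrite filter_in_none => [|_ /mapP[v _ ->]]; last by rewrite fi; clear; lia.
      by rewrite filter_in_none ?cats0 // => _ /mapP[v _ ->]; rewrite gi; clear; lia.
    - rewrite filter_in_none => [|v /(in1 _ _ z1)/lei]; last by clear; lia.
      rewrite filter_in_all => [|_ /mapP[v /(in2 _ _ z2)/lei vb ->]]; last by rewrite fi; move: vb; clear; lia.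
      by rewrite filter_in_none ?cats0 // => _ /mapP[v _ ->]; rewrite gi; clear; lia.
    - rewrite filter_in_none => [|v /(in1 _ _ z1)/lei]; last by clear; lia.
      rewrite filter_in_none => [|_ /mapP[v /(in2 _ _ z2)/lei vb ->]]; last by rewrite fi; move: vb; clear; lia.
      by rewrite filter_in_all // => _ /mapP[v _ ->]; rewrite gi; clear; lia.
  have [xp xf xg] := dec x x1 x2 x3; have [yp yf yg] := dec y y1 y2 y3.
  rewrite {}xy in xp xf xg.
  have e1 : x.1.1 = y.1.1 by rewrite -xp.
  have e2 : x.1.2 = y.1.2.
    have fe : map f x.1.2 = map f y.1.2 by rewrite -xf.
    apply: (inj_in_map (A := [pred z | ple z (setc t i b)])) fe => [u v||].
    - exact: f_inj.
    - by apply/allP => z; exact: in2 x2.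
    - by apply/allP => z; exact: in2 y2.
  have e3 : x.2 = y.2 by apply: (inj_map g_inj); rewrite -xg.
  by move: e1 e2 e3; clear; move: x y => [[? ?] ?] [[? ?] ?] /= -> -> ->.
move=> _ /mapP[x /XE[x1 x2 x3] ->].
have saw1 : saw (pconst d 0) (setc t i a) x.1.1 by case/andP: (c1 _ x1).
have saw2 : saw (f (pconst d 0)) (f (setc t i b)) (map f x.1.2).
  have sub2 := in2 _ _ x2; case/andP: (c2 _ x2) => + _; apply: saw_map => u v /sub2 ub /sub2 vb.
    exact: f_inj ub vb.
  exact: f_adj ub vb.
have saw3 : saw (g (pconst d 0)) (g (setc t i c)) (map g x.2).
  by case/andP: (c3 _ x3) => + _; apply: saw_map => u v _ _; [apply: g_inj | apply: g_adj].
have adj12 : padj (setc t i a) (f (pconst d 0)).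
  have -> : f (pconst d 0) = pincr i (setc t i a); last exact: padj_pincr.
  by apply/ffunP => k; rewrite !ffunE; case: eqP => _; clear; lia.
have adj23 : padj (f (setc t i b)) (g (pconst d 0)).
  have -> : g (pconst d 0) = pincr i (f (setc t i b)); last exact: padj_pincr.
  by apply/ffunP => k; rewrite !ffunE; case: eqP => _; clear; lia.
have endE : g (setc t i c) = setc t i (a + b + 2 + c).
  by apply/ffunP => k; rewrite !ffunE; case: eqP.
have dis23 : {in map g x.2, forall z, z \notin map f x.1.2}.
  move=> _ /mapP[z _ ->]; apply/mapP => -[y /(in2 _ _ x2)/lei yb] /ffunP/(_ i).
  by rewrite gi fi; move: yb; clear; lia.
have dis1 : {in map f x.1.2 ++ map g x.2, forall z, z \notin x.1.1}.
  move=> z; rewrite mem_cat => zfg; apply/negP => /(in1 _ _ x1)/lei; apply/negP.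
  by case/orP: zfg => /mapP[y _ ->]; rewrite ?fi ?gi; clear; lia.
rewrite /pcrossing -endE (saw_cat saw1 (saw_cat saw2 saw3 adj23 dis23) adj12 dis1) endE.
apply/allP => z; rewrite !mem_cat => /or3P[/(in1 _ _ x1) | /mapP[y /(in2 _ _ x2) yt ->] | /mapP[y /(in3 _ _ x3) yt ->]].
- move/pleP => zt; apply/pleP => k; move: (zt k); rewrite !ffunE; case: eqP => // _; clear; lia.
- apply/pleP => k; move/pleP: yt => /(_ k); rewrite !ffunE; case: eqP => _; clear; lia.
- apply/pleP => k; move/pleP: yt => /(_ k); rewrite !ffunE; case: eqP => // _; clear; lia.
Qed.

(** Each induction step adds two boxes, which keeps their number odd. The 2h + 1 boxes have (2h +
    1)(a + 1) layers, and the far index is one less. *)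
Lemma many_crossings_stack d (t : gridpt d) i a K h :
    many_crossings (setc t i a) K ->
  many_crossings (setc t i (h.*2 * a.+1 + a)) (K ^ h.*2.+1).
Proof.
move=> mK; elim: h => [|h IH]; first by rewrite expn1.
have := many_crossings_stack3 IH mK mK; congr (many_crossings (setc _ _ _) _); first lia.
by rewrite doubleS !expnSr.
Qed.

Lemma many_crossings_pconst d L K :
  many_crossings (pconst d L) K <-> K <= num_crossings d L.
Proof.
split=> [[S [uS cS <-]] | leK]; first exact: leq_num_crossings.
exists (take K (pcrossings d L)); split; first by rewrite take_uniq ?uniq_pcrossings.
  by move=> w /mem_take; rewrite mem_pcrossings.
by rewrite size_takel // size_pcrossings.
Qed.

Lemma num_crossings_stack d L h :
  num_crossings d L ^ (h.*2.+1 ^ d) <= num_crossings d (h.*2 * L.+1 + L).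
Proof.
set m := h.*2.+1; set M := h.*2 * L.+1 + L.
(* [t n] is the far corner after stacking along the first [n] axes *)
pose t n : gridpt d := [ffun k : 'I_d => if k < n then M else L].
suff tn n : n <= d -> many_crossings (t n) (num_crossings d L ^ (m ^ n)).
  apply/many_crossings_pconst; have -> : pconst d M = t d by apply/ffunP => k; rewrite !ffunE ltn_ord.
  exact: tn.
elim: n => [_ | n IH lt_nd].
  have -> : t 0 = pconst d L by apply/ffunP => k; rewrite !ffunE.
  by rewrite expn1; apply/many_crossings_pconst.
pose i := Ordinal lt_nd;
have -> : t n.+1 = setc (t n) i M.
  apply/ffunP => k; rewrite !ffunE -val_eqE /= ltnS leq_eqVlt; by case: eqP.
rewrite expnS mulnC expnM; apply: many_crossings_stack.
have -> : setc (t n) i L = t n; last exact: IH (ltnW lt_nd).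
by apply/ffunP => k; rewrite !ffunE; case: eqP => // ->; rewrite /= ltnn.
Qed.


(** * From polygons to crossings *)

Lemma cycle_edges_rot d L n (c : seq (site d L)) :
  uniq c -> cycle_edges (rot n c) = cycle_edges c.
Proof.
move=> uc; apply/setP => e; apply/imsetP/imsetP => -[x xc ->]; exists x.
- by rewrite mem_rot in xc.
- by rewrite next_rot.
- by rewrite mem_rot.
- by rewrite next_rot.
Qed.

Lemma cycle_edges_rev d L (c : seq (site d L)) :
  uniq c -> cycle_edges (rev c) = cycle_edges c.
Proof.
move=> uc; apply/setP => e; apply/imsetP/imsetP => -[x].
  rewrite mem_rev => xc ->; exists (prev c x); first by rewrite mem_prev.
  by rewrite next_rev // next_prev // finset.setUC.
move=> xc ->; exists (next c x); first by rewrite mem_rev mem_next.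
by rewrite next_rev // prev_next // finset.setUC.
Qed.

(** Rotation makes the edge in the face the closing edge of the cycle. Reversal, if necessary, makes
    the last vertex the larger endpoint, so that the last vertex is a + e_j. *)
Lemma polygon_rooted d L (E : {set {set site d L}}) (k : 'I_d) :
    polygon E -> has_edge_in E (face k ord0) ->
  exists j (a : site d L) s,
    [/\ uniq (a :: s), path (@adj d L) a s, E = cycle_edges (a :: s),
        j != k & [/\ pt_of_site (last a s) = pincr j (pt_of_site a), a k = ord0
        & last a s k = ord0]].
Proof.
case=> c0 [sc0 uc0 cc0 ->] /existsP[_ /andP[/imsetP[x xc ->] /fintype.subsetP sub]].
have := sub x; have := sub (next c0 x); rewrite !inE !eqxx ?orbT => /(_ isT)/eqP y0 /(_ isT)/eqP x0.
move: y0; rewrite -(next_rot 0 uc0) rot0; case/rot_to: (xc) => n c cE.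
rewrite -(next_rot n uc0) -(cycle_edges_rot n uc0) cE.
have {sc0} : 2 < size (x :: c) by rewrite -cE size_rot.
have {uc0} : uniq (x :: c) by rewrite -cE rot_uniq.
have {cc0 cE} : cycle (@adj d L) (x :: c) by rewrite -cE rot_cycle.
case: c => [|y s] // cc uc _; rewrite [next _ x]/= eqxx => y0.
have /padjP[j xy] : padj (pt_of_site x) (pt_of_site y).
  by rewrite padj_pt_of_site; case/andP: cc.
have jk : j != k.
  apply/eqP => jk; case: xy => /ffunP/(_ k); rewrite !ffunE jk eqxx x0 y0 //.
case: xy => xy.
- have rE : rev (rot 1 [:: x, y & s]) = x :: rcons (rev s) y.
    by rewrite rot1_cons rev_rcons rev_cons.
  exists j, x, (rcons (rev s) y); rewrite last_rcons -rE rev_uniq rot_uniq.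
  rewrite cycle_edges_rev ?rot_uniq // cycle_edges_rot //; split=> //.
  have : cycle (@adj d L) (rev (rot 1 [:: x, y & s])).
    rewrite rev_cycle rot_cycle; apply: sub_cycle cc => u v /=.
    by rewrite -!padj_pt_of_site padj_sym.
  by rewrite rE /= rcons_path => /andP[].
- have rE : rot 1 [:: x, y & s] = y :: rcons s x by rewrite rot1_cons.
  exists j, y, (rcons s x); rewrite last_rcons -rE rot_uniq cycle_edges_rot //.
  split=> //; have := cc; rewrite -(rot_cycle 1) rE /= rcons_path.
  by case/andP.
Qed.

(** The crossing visits the lifted polygon exactly at its points off the layer
    [z k = 0] whose other coordinates are at most [L]. *)
Lemma polygon_crossing d L (E : {set {set site d L}}) (k : 'I_d) :
    polygon E -> has_edge_in E (face k ord0) ->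
  exists2 w, pcrossing (pconst d L.+1) w &
    E = cycle_edges [seq site_of_pt L (setc z k (z k).-1) |
      z : gridpt d <- w & (0 < z k) && [forall i, (i != k) ==> (z i <= L)]].
Proof.
move=> polyE edgeE.
have [j [a [s [us ps -> jk [bE ak bk]]]]] := polygon_rooted polyE edgeE.
have pt_inj := can_inj (@pt_of_siteK d L).
pose b := last a s; pose lift z := pincr k z.
pose u := setc (pconst d L.+1) k 0.
have liftk z : lift z k = (z k).+1 by rewrite ffunE eqxx.
have lifti z i : i != k -> lift z i = z i by rewrite ffunE => /negPf->.
have ptk (x : site d L) : x k = ord0 -> pt_of_site x k = 0 by rewrite ffunE => ->.
have bj : pt_of_site b j = (pt_of_site a j).+1 by rewrite bE ffunE eqxx.
have sub0a : ple (pconst d 0) (pt_of_site a) by apply/pleP => i; rewrite ffunE.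
have [w1 [saw1 bet1]] := saw_between sub0a.
have subbu : ple (pt_of_site b) u.
  apply/pleP => i; have [->|ik] := eqVneq i k; first by rewrite ptk.
  by have /pleP/(_ i) := ple_pt_of_site b; rewrite !ffunE (negPf ik) => /leqW.
have [w2 [saw2 bet2]] := saw_between subbu.
have subu : ple (pincr k u) (pconst d L.+1).
  by apply/pleP => i; rewrite !ffunE; case: eqP.
have [w3 [saw3 bet3]] := saw_between subu.
(* The order of the pieces is [w1] to [a], [c] along the lifted polygon, [w2] from [b] to the corner
   [u] of the freed layer, and [w3] up to the far corner. *)
pose c := [seq lift (pt_of_site x) | x <- a :: s].
have sawc : saw (lift (pt_of_site a)) (lift (pt_of_site b)) c.
  rewrite /c (map_comp lift); apply: saw_map => [x y _ _ /ffunP xy | x y _ _ |].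
  - apply/ffunP => i; have := xy i; rewrite !ffunE; case: eqP => // _; exact: succn_inj.
  - congr (_ == _); apply: eq_bigr => i _; rewrite !ffunE; case: eqP => // _; lia.
  rewrite /saw map_cons -map_cons map_inj_uniq // us eqxx last_map eqxx !andbT /=.
  elim: (s) (a) ps => //= y s' IH x /andP[xy ys']; rewrite padj_pt_of_site xy; exact: IH.
(* Coordinates [j] and [k] separate the pieces: [w1] and [w2] lie in the layer 0 of direction [k],
   on either side in direction [j], while [c] and [w3] lie above it, with coordinate [j] at most L
   and above L respectively. *)
have z1 z : z \in w1 -> z k = 0 /\ z j <= pt_of_site a j.
  case/bet1 => _ /pleP za; split; last exact: za.
  by apply/eqP; rewrite -leqn0 -(ptk a ak).
have zc z : z \in c -> 0 < z k /\ forall i, i != k -> z i <= L.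
  case/mapP => x _ ->; rewrite liftk; split=> // i ik.
  by rewrite lifti // ffunE -ltnS.
have z2 z : z \in w2 -> z k = 0 /\ pt_of_site a j < z j.
  case/bet2 => /pleP bz /pleP zu; rewrite -bj; split; last exact: bz.
  by apply/eqP; rewrite -leqn0; have := zu k; rewrite ffunE eqxx.
have z3 z : z \in w3 -> 0 < z k /\ L < z j.
  case/bet3 => /pleP uz _; split; first by have := uz k; rewrite !ffunE eqxx; apply: leq_trans.
  by have := uz j; rewrite !ffunE (negPf jk).
exists (w1 ++ (c ++ (w2 ++ w3))).
  have dis23 : {in w3, forall z, z \notin w2}.
    by move=> z /z3[zk _]; apply/negP => /z2[zk0 _]; rewrite zk0 in zk.
  have disc : {in w2 ++ w3, forall z, z \notin c}.
    move=> z zw; apply/negP => /zc[zk /(_ _ jk) zj]; move: zw; rewrite mem_cat.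
    case/orP => [/z2[zk0 _] | /z3[_]]; first by rewrite zk0 in zk.
    by rewrite ltnNge zj.
  have dis1 : {in c ++ (w2 ++ w3), forall z, z \notin w1}.
    move=> z zw; apply/negP => /z1[zk0 zj]; move: zw; rewrite !mem_cat.
    case/or3P => [/zc[]|/z2[_]|/z3[]]; rewrite ?zk0 //.
    by rewrite ltnNge zj.
  have adj_b : padj (lift (pt_of_site b)) (pt_of_site b).
    by rewrite padj_sym padj_pincr.
  have saw23 := saw_cat saw2 saw3 (padj_pincr _ _) dis23.
  have sawc23 := saw_cat sawc saw23 adj_b disc.
  rewrite /pcrossing (saw_cat saw1 sawc23 (padj_pincr _ _) dis1) andTb.
  apply/allP => z; rewrite !mem_cat => /or4P[/bet1[_ za]|/mapP[x _ ->]|/bet2[_ zu]|/bet3[] //].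
  - apply: ple_trans za (ple_trans (ple_pt_of_site a) _); exact: ple_pconst.
  - apply/pleP => i; have /pleP/(_ i) := ple_pt_of_site x; rewrite !ffunE.
    by case: eqP => // _ /leqW.
  - by apply: ple_trans zu _; apply: ple_trans subu; apply/pleP => i; rewrite !ffunE; case: eqP.
rewrite !filter_cat filter_in_none => [|z /z1[-> _] //].
rewrite filter_in_all => [|z /zc[-> zL]]; last by apply/forallP => i; apply/implyP; exact: zL.
rewrite filter_in_none => [|z /z2[-> _] //].
rewrite filter_in_none ?cats0 => [|z /z3[_ zj]]; last first.
  by rewrite negb_and; apply/orP; right; apply/forallPn; exists j; rewrite jk /= -ltnNge.
(* Only [c] survives the filter, with the vertices in cyclic order; [cycle_edges] closes the list up
   and so restores the edge that was cut. *)
congr cycle_edges; rewrite /= -map_comp -[LHS]map_id; apply: eq_map => x /=.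
rewrite -[LHS]pt_of_siteK; congr site_of_pt; apply/ffunP => i.
by rewrite [RHS]ffunE liftk /=; case: eqVneq => [->|ik]; rewrite ?lifti.
Qed.

(** Every spanning polygon is decoded by [dec k] from some crossing; the factor d accounts for the
    choice of the direction [k]. *)
Lemma num_spanning_polygons_le d L :
  num_spanning_polygons d L <= d * num_crossings d L.+1.
Proof.
pose dec (k : 'I_d) w := cycle_edges [seq site_of_pt L (setc z k (z k).-1) |
  z : gridpt d <- w & (0 < z k) && [forall i, (i != k) ==> (z i <= L)]].
apply: (@leq_trans (size [seq dec k w | k <- enum 'I_d, w <- pcrossings d L.+1])); last first.
  by rewrite size_allpairs size_enum_ord size_pcrossings.
rewrite /num_spanning_polygons cardE; apply: uniq_leq_size (enum_uniq _) _ => E; rewrite mem_enum inE => /andP[/asboolP polyE].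
case/existsP=> k /andP[edgeE _]; have [w wC ->] := polygon_crossing polyE edgeE.
by apply: allpairs_f; rewrite ?mem_enum // mem_pcrossings.
Qed.

(** * Growth constant *)

Local Open Scope classical_set_scope.
Local Open Scope ring_scope.

Lemma cvg_horner_invn (R : realType) (p : {poly R}) (f : nat -> R) (l : R) :
    (forall n, p.[n%:R^-1] = f n) -> p.[0] = l ->
  f n @[n --> \oo] --> l.
Proof.
move=> pf <-; have <- : (fun n : nat => p.[n%:R^-1]) = f by apply/funext.
apply: continuous_cvg; first exact: continuous_horner.
rewrite -cvg_shiftS; exact: cvg_harmonic.
Qed.

(** A Fekete argument in d dimensions, applied later to c = ln C. The limit is the supremum of c(L)
    / (L + 1)^d, which gives the bound for every L at once. *)
Lemma cvg_stacking (R : realType) d (c : nat -> R) (K : R) :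
    (forall L, 0 <= c L) ->
    (forall L M, (L <= M)%N -> c L <= c M) ->
    (forall L, c L <= K * L.+1%:R ^+ d) ->
    (forall L h, h.*2.+1%:R ^+ d * c L <= c (h.*2 * L.+1 + L)%N) ->
  exists2 l : R, c L / L%:R ^+ d @[L --> \oo] --> l &
    forall L, c L <= l * L.+1%:R ^+ d.
Proof.
move=> c0 c_mono c_ub c_stack.
have pos L : 0 < L.+1%:R ^+ d :> R by rewrite exprn_gt0.
pose u L := c L / L.+1%:R ^+ d; pose l := sup (range u).
have u_ub : has_ubound (range u).
  by exists K => _ [L _ <-]; rewrite /u ler_pdivrMr.
have ul L : u L <= l by apply: ub_le_sup => //; exists L.
exists l; last by move=> L; rewrite -ler_pdivrMr //; exact: ul.
have lowM L M : (L.+1.*2 < M)%N -> (1 - L.+1.*2%:R / M.+1%:R) ^+ d * u L <= u M.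
  (* Here 2h + 1 is the largest odd m with m (L + 1) <= M + 1; less than 2 (L + 1) layers are left
     over. *)
  move=> LM; pose h := ((M.+1 %/ L.+1).-1)./2.
  have [h1 h2] : ((h.*2.+1 * L.+1 <= M.+1) /\ (M.+1 <= h.*2.+1 * L.+1 + L.+1.*2))%N.
    have q1 : (0 < M.+1 %/ L.+1)%N by rewrite divn_gt0 //; lia.
    have := divn_eq M.+1 L.+1; have := ltn_pmod M.+1 (ltn0Sn L).
    move: q1; rewrite /h; move: (M.+1 %/ L.+1)%N (M.+1 %% L.+1)%N => q r.
    case: q => // q _ rL ->; have := odd_double_half q.
    by move: (q./2) => p qp; move: rL; rewrite /=; case: (odd q) qp => /= <-; nia.
  have M0 : 0 < M.+1%:R :> R by rewrite ltr0n.
  rewrite [leRHS]/u ler_pdivlMr // mulrAC -exprMn mulrBl mul1r divfK ?gt_eqF //.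
  apply: le_trans (c_mono (h.*2 * L.+1 + L)%N M _); last by lia.
  apply: le_trans (c_stack L h).
  rewrite /u mulrA ler_pdivrMr // mulrAC -exprMn ler_wpM2r //.
  have LM' : L.+1.*2%:R <= M.+1%:R :> R by rewrite ler_nat; lia.
  apply: lerXn2r; rewrite ?nnegrE ?subr_ge0 ?mulr_ge0 //.
  by rewrite lerBlDr -natrM -natrD ler_nat; lia.
have ucvg : u L @[L --> \oo] --> l.
  apply/cvgrPdist_le => e e0.
  have [_ [L _ <-] luL] := sup_adherent e0 (conj (ex_intro _ _ (imageT u 0%N)) u_ub).
  have pcvg : (1 - L.+1.*2%:R / M%:R) ^+ d * u L @[M --> \oo] --> u L.
    rewrite -[X in _ --> X]mul1r; apply: cvgM; last exact: cvg_cst.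
    apply: (@cvg_horner_invn R ((1 - L.+1.*2%:R *: 'X) ^+ d)) => [M|].
      by rewrite !hornerE.
    by rewrite !hornerE subr0 expr1n.
  rewrite -cvg_shiftS in pcvg.
  near=> M.
  have lM : sup (range u) - e <= (1 - L.+1.*2%:R / M.+1%:R) ^+ d * u L.
    by near: M; exact: (cvgr_ge _ pcvg _ luL).
  have LM : (L.+1.*2 < M)%N by near: M; exact: nbhs_infty_gt.
  rewrite ger0_norm ?subr_ge0 ?ul // lerBlDr addrC -lerBlDr.
  exact: le_trans lM (lowM _ _ LM).
(* The factor (1 + 1/M)^d converts the normalisation by (M + 1)^d into the one by M^d. *)
have rcvg : (1 + M%:R^-1) ^+ d * u M @[M --> \oo] --> l.
  rewrite -[l]mul1r; apply: cvgM => //.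
  apply: (@cvg_horner_invn R ((1 + 'X) ^+ d)) => [M|]; rewrite !hornerE //.
  by rewrite expr1n.
apply: cvg_trans rcvg; apply: near_eq_cvg; near=> M.
have M0 : (0 < M)%N by near: M; exact: nbhs_infty_gt.
have M0' : 0 < M%:R :> R by rewrite ltr0n.
rewrite /u mulrCA; congr (_ * _); rewrite -exprVn -exprMn -exprVn; congr (_ ^+ _).
rewrite -natr1; have : M%:R + 1 != 0 :> R by rewrite gt_eqF // ltr_wpDl.
have : M%:R != 0 :> R by rewrite gt_eqF.
by move: (M%:R : R) => x x0 x1; field; rewrite x0 x1.
Unshelve. all: by end_near. Qed.

Lemma ln_natX (R : realType) m n : (0 < m)%N -> ln (m ^ n)%N%:R = n%:R * ln m%:R :> R.
Proof. by move=> m0; rewrite natrX lnXn ?ltr0n // mulr_natl. Qed.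

Lemma ler_ln_nat (R : realType) m n :
  (0 < m)%N -> (m <= n)%N -> ln m%:R <= ln n%:R :> R.
Proof.
by move=> m0 mn; rewrite ler_ln ?posrE ?ltr0n ?ler_nat //; exact: leq_trans mn.
Qed.

Lemma crossing_growthP (R : realType) d : (1 < d)%N ->
  0 < crossing_growth R d /\
  forall L, ln (num_crossings d L)%:R <= crossing_growth R d * L.+1%:R ^+ d.
Proof.
move=> d1; have d0 := ltnW d1; have N0 L := num_crossings_gt0 L d0.
have [|L M LM|L|L h|l cl ub] := @cvg_stacking R d
    (fun L => ln (num_crossings d L)%:R) (ln d.*2.+1%:R).
- by move=> L; rewrite ln_ge0 // ler1n.
- exact: ler_ln_nat (leq_num_crossings_side d0 LM).
- rewrite -natrX mulrC -ln_natX //; apply: ler_ln_nat => //.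
  exact: num_crossings_ub.
- rewrite -natrX -ln_natX //; apply: ler_ln_nat; first by rewrite expn_gt0 N0.
  exact: num_crossings_stack.
(* Convergence is now known, so the [limn] in [crossing_growth] is a genuine limit and not a default
   value. *)
have -> : crossing_growth R d = l by apply: cvg_lim.
split=> //; have : 0 < l * 2%:R ^+ d.
  by apply: lt_le_trans (ub 1%N); rewrite ln_gt0 // ltr1n num_crossings1_gt1.
by rewrite pmulr_lgt0 // exprn_gt0.
Qed.

Theorem theorem6 (R : realType) (d : nat) (hd : (2 <= d)%N) :
  exists r : nat -> R,
    ((fun L : nat => r L / L%:R ^+ d.-1) @ \oo --> (0 : R)) /\
    (forall L : nat, (1 <= L)%N ->
      ln (num_spanning_polygons d L)%:R <=
      (L%:R ^+ d + 2 * d%:R * L%:R ^+ d.-1 + r L) * ln (lambda R d)).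
Proof.
have [l0 ub] := crossing_growthP R hd; set l := crossing_growth R d in l0 ub.
have d0 : (0 < d)%N by exact: ltnW.
(* Chosen so that the exponent is exactly (L + 2)^d + ln d / l; multiplied by ln lambda = l, the
   last term gives ln d. *)
pose r L : R := L.+2%:R ^+ d - L%:R ^+ d - 2 * d%:R * L%:R ^+ d.-1 + ln d%:R / l.
exists r; split.
  (* This is r(L) / L^(d - 1) as a polynomial in 1/L, from (L + 2)^d - L^d = 2 sum_i (L + 2)^(d - 1
     - i) L^i. At 0 the sum gives 2d, which cancels, and the last term vanishes because d >= 2. *)
  pose q : {poly R} := 2 *: (\sum_(i < d) (1 + 2 *: 'X) ^+ (d.-1 - i)) - (2 * d%:R)%:P
                       + (ln d%:R / l) *: 'X ^+ d.-1.
  have q0 : q.[0] = 0.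
    rewrite /q !hornerE horner_sum (eq_bigr (fun=> 1)) => [|i _]; last first.
      by rewrite !hornerE expr1n.
    rewrite sumr_const card_ord expr0n -subn1 subn_eq0 leqNgt hd mulr0 addr0.
    by rewrite subrr.
  have qcvg := @cvg_horner_invn R q _ 0 (fun=> erefl) q0.
  apply: cvg_trans qcvg; apply: near_eq_cvg; near=> L.
  have L0 : L%:R != 0 :> R by rewrite pnatr_eq0 -lt0n; near: L; exact: nbhs_infty_gt.
  have E2 : L.+2%:R - L%:R = 2 :> R by rewrite -addn2 natrD addrAC subrr add0r.
  have Ld n : (n <= d.-1)%N -> L%:R ^+ n / L%:R ^+ d.-1 = L%:R^-1 ^+ (d.-1 - n) :> R.
    by move=> nd; rewrite exprVn -{1}(subnK nd) exprD invfM mulrCA divff ?mulr1 // expf_neq0.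
  rewrite /r subrXX E2 mulrDl mulrBl mulfK ?expf_neq0 // -[2 * _ / _]mulrA mulr_suml.
  rewrite /q !hornerE horner_sum exprVn; congr (2 * _ - _ + _).
  apply: eq_bigr => i _; rewrite !hornerE.
  have id : (i <= d.-1)%N by rewrite -ltnS prednK.
  rewrite -mulrA Ld // -exprMn; congr (_ ^+ _).
  by rewrite -[X in X + _](divff L0) -mulrDl -natrD addn2.
move=> L L1; have -> : ln (lambda R d) = l by rewrite /lambda expRK.
have -> : L%:R ^+ d + 2 * d%:R * L%:R ^+ d.-1 + r L = L.+2%:R ^+ d + ln d%:R / l.
  by rewrite /r; ring.
rewrite mulrDl divfK ?gt_eqF //.
(* With no polygon the left side is ln 0, which is 0 by convention, so the right side has to be
   nonnegative. *)
have := num_spanning_polygons_le d L; case: (num_spanning_polygons d L) => [_|n le_n].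
  rewrite ln0 // addr_ge0 ?mulr_ge0 ?exprn_ge0 ?ln_ge0 ?ler1n //; exact: ltW.
apply: le_trans (ler_ln_nat R _ le_n) _ => //.
rewrite natrM lnM ?posrE ?ltr0n ?num_crossings_gt0 // addrC lerD2r mulrC.
exact: ub.
Unshelve. all: by end_near. Qed.
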